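(* Given a real number $\mu$, let a hyperplane $x_k=\beta_0+\beta_1x_1+\beta_2x_2+\dots+\beta_{k-1}x_{k-1}$ in $\mathbb R^k$ have the directional hyperplanar moment of inertia in direction $Cx_k$ equal to $\mu$. Then the coefficients $\beta_0$ and $\beta=(\beta_1,\dots,\beta_{k-1})$ of the hyperplane satisfy the equation $$\langle K_1\beta,\beta\rangle-2\langle b,\beta\rangle+m\beta_0^2+J_{kk}=\mu .$$ By varying the moment of inertia $\mu$, these equations represent a family of homothetic ellipsoids in the space of parameters $\beta_0,\beta_1,\dots,\beta_{k-1}$.
   Context: Let $k\ge2$ and let $N$ points $M_i=(x_1^{(i)},\dots,x_k^{(i)})\in\mathbb R^k$ with masses $m_i>0$ be given, with total mass $m=\sum_im_i$, not all contained in a proper affine subspace (full rank assumption). The origin of the coordinate system is the center of masses $C$, so $\sum_im_ix_j^{(i)}=0$ for $j=1,\dots,k$. The hyperplanar operator of inertia at $C$ has entries $J_{jl}=\sum_im_ix_j^{(i)}x_l^{(i)}$, $1\le j,l\le k$. $K_1=(J_{jl})_{1\le j,l\le k-1}$ is its upper-left $(k-1)\times(k-1)$ submatrix and $b=(J_{1k},\dots,J_{k-1\,k})^T$. For a hyperplane $\pi$ not parallel to the $x_k$-axis, the directional hyperplanar moment of inertia in direction $Cx_k$ is $\sum_im_i\hat D_i^2$, where $\hat D_i$ is the distance between $M_i$ and the intersection of $\pi$ with the line through $M_i$ parallel to the $x_k$-axis. *)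

(* Defs.v *)
From HB Require Import structures.
From mathcomp Require Import all_boot all_order all_algebra.
From mathcomp Require Import boolp classical_sets reals.

Set Implicit Arguments.
Unset Strict Implicit.
Unset Printing Implicit Defensive.

Import Order.TTheory GRing.Theory Num.Theory.

Local Open Scope classical_set_scope.
Local Open Scope ring_scope.

(* The ambient dimension k is written n.+1.  The coordinates x_1, ..., x_{k-1}
   are those of index [lift ord_max j], whose value is j, and x_k is the one of
   index [ord_max]. *)

Definition dot (R : realType) (d : nat) (u v : 'cV[R]_d) : R :=
  \sum_(j < d) u j 0 * v j 0.

(* The norm that mathcomp-analysis puts on matrices is the sup norm, hence an
   explicit Euclidean distance. *)
Definition edist (R : realType) (d : nat) (u v : 'cV[R]_d) : R :=
  Num.sqrt (dot (u - v) (u - v)).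

Definition total_mass (R : realType) (N : nat) (m : 'I_N -> R) : R :=
  \sum_(i < N) m i.

Definition in_proper_affine_subspace (R : realType) (d N : nat)
    (x : 'I_N -> 'cV[R]_d) : Prop :=
  exists (p : 'cV[R]_d) (U : {vspace 'cV[R]_d}),
    U <> fullv /\ (forall i, x i - p \in U).

Definition inertia_op (R : realType) (d N : nat) (m : 'I_N -> R)
    (x : 'I_N -> 'cV[R]_d) : 'M[R]_d :=
  \matrix_(j, l) \sum_(i < N) m i * x i j 0 * x i l 0.

Definition upper_left (R : realType) (n : nat) (J : 'M[R]_n.+1) : 'M[R]_n :=
  \matrix_(j, l) J (lift ord_max j) (lift ord_max l).

Definition last_col (R : realType) (n : nat) (J : 'M[R]_n.+1) : 'cV[R]_n :=
  \col_j J (lift ord_max j) ord_max.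

Definition hyperplane (R : realType) (n : nat) (beta0 : R) (beta : 'cV[R]_n) :
    set 'cV[R]_n.+1 :=
  [set y | y ord_max 0 =
           beta0 + \sum_(j < n) beta j 0 * y (lift ord_max j) 0].

Definition line (R : realType) (d : nat) (p v : 'cV[R]_d) : set 'cV[R]_d :=
  [set y | exists t : R, y = p + t *: v].

(* [xget p A] is an element of A if A is nonempty, and p otherwise; when the
   hyperplane is not parallel to v the intersection is a single point. *)
Definition directional_dist (R : realType) (d : nat) (pi : set 'cV[R]_d)
    (v p : 'cV[R]_d) : R :=
  edist p (xget p (pi `&` line p v)).

Definition directional_moment (R : realType) (d N : nat) (m : 'I_N -> R)
    (x : 'I_N -> 'cV[R]_d) (v : 'cV[R]_d) (pi : set 'cV[R]_d) : R :=
  \sum_(i < N) m i * directional_dist pi v (x i) ^+ 2.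

Definition coef_form (R : realType) (n N : nat) (m : 'I_N -> R)
    (x : 'I_N -> 'cV[R]_n.+1) (beta0 : R) (beta : 'cV[R]_n) : R :=
  let J := inertia_op m x in
  dot (upper_left J *m beta) beta - 2 * dot (last_col J) beta
  + total_mass m * beta0 ^+ 2 + J ord_max ord_max.

(* The point (beta_0, beta_1, ..., beta_{k-1}) of the space of parameters is
   [col_mx beta0%:M beta]. *)
Definition coef_locus (R : realType) (n N : nat) (m : 'I_N -> R)
    (x : 'I_N -> 'cV[R]_n.+1) (mu : R) : set 'cV[R]_(1 + n) :=
  [set w | exists (beta0 : R) (beta : 'cV[R]_n),
     w = col_mx beta0%:M beta /\ coef_form m x beta0 beta = mu].

Definition posdef (R : realType) (d : nat) (Q : 'M[R]_d) : Prop :=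
  Q^T = Q /\ forall u : 'cV[R]_d, u <> 0 -> 0 < dot (Q *m u) u.

Definition ellipsoid (R : realType) (d : nat) (E : set 'cV[R]_d) : Prop :=
  exists (c : 'cV[R]_d) (Q : 'M[R]_d),
    posdef Q /\ E = [set w | dot (Q *m (w - c)) (w - c) = 1].

Definition homothety (R : realType) (d : nat) (c : 'cV[R]_d) (r : R)
    (w : 'cV[R]_d) : 'cV[R]_d :=
  c + r *: (w - c).

Definition homothetic (R : realType) (d : nat) (A B : set 'cV[R]_d) : Prop :=
  exists (c : 'cV[R]_d) (r : R), r != 0 /\ B = homothety c r @` A.

(* Main.v *)
(* The moment in direction C x_k of the hyperplane (beta_0, beta) is the mass
   weighted sum of squared residuals beta_0 + <beta, x'> - x_k; expanding it, the
   cross terms in beta_0 vanish because the origin is the center of masses.  The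
   full rank assumption makes K_1 positive definite, so completing the square
   around the regression hyperplane (0, K_1^-1 b) turns the equation into
   q(w - c) = mu - mu_0, where q is positive definite and c, mu_0 do not depend
   on mu. *)
Require Import Defs.
From mathcomp Require Import all_boot all_order all_algebra.
From mathcomp Require Import boolp classical_sets reals.
From mathcomp Require Import ring.

Set Implicit Arguments.
Unset Strict Implicit.
Unset Printing Implicit Defensive.

Import Order.TTheory GRing.Theory Num.Theory.

Local Open Scope classical_set_scope.
Local Open Scope ring_scope.

(** * Algebra of the Euclidean inner product *)

Lemma dotE (R : realType) (d : nat) (u v : 'cV[R]_d) :
  dot u v = (u^T *m v) 0 0.
Proof. by rewrite mxE; apply: eq_bigr => j _; rewrite mxE. Qed.

Lemma dotC (R : realType) (d : nat) (u v : 'cV[R]_d) : dot u v = dot v u.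
Proof. by apply: eq_bigr => j _; rewrite mulrC. Qed.

Lemma dotDl (R : realType) (d : nat) (u v w : 'cV[R]_d) :
  dot (u + v) w = dot u w + dot v w.
Proof. by rewrite !dotE linearD mulmxDl mxE. Qed.

Lemma dotZl (R : realType) (d : nat) (a : R) (u v : 'cV[R]_d) :
  dot (a *: u) v = a * dot u v.
Proof. by rewrite !dotE linearZ -scalemxAl mxE. Qed.

Lemma dotBl (R : realType) (d : nat) (u v w : 'cV[R]_d) :
  dot (u - v) w = dot u w - dot v w.
Proof. by rewrite dotDl -scaleN1r dotZl mulN1r. Qed.

Lemma dotBr (R : realType) (d : nat) (u v w : 'cV[R]_d) :
  dot u (v - w) = dot u v - dot u w.
Proof. by rewrite dotC dotBl !(dotC u). Qed.

Lemma dotZr (R : realType) (d : nat) (a : R) (u v : 'cV[R]_d) :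
  dot u (a *: v) = a * dot u v.
Proof. by rewrite dotC dotZl dotC. Qed.

Lemma dot0r (R : realType) (d : nat) (u : 'cV[R]_d) : dot u 0 = 0.
Proof. by rewrite dotE mulmx0 mxE. Qed.

Lemma dot_mulmxl (R : realType) (d : nat) (Q : 'M[R]_d) (u v : 'cV[R]_d) :
  dot (Q *m u) v = dot u (Q^T *m v).
Proof. by rewrite !dotE trmx_mul mulmxA. Qed.

Lemma dot_col_mx (R : realType) (d e : nat) (u u' : 'cV[R]_d) (v v' : 'cV[R]_e) :
  dot (col_mx u v) (col_mx u' v') = dot u u' + dot v v'.
Proof. by rewrite !dotE tr_col_mx mul_row_col mxE. Qed.

(** * Positive definite matrices *)

Lemma posdef_ge0 (R : realType) (d : nat) (Q : 'M[R]_d) (u : 'cV[R]_d) :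
  posdef Q -> 0 <= dot (Q *m u) u.
Proof.
move=> [_ Qpos]; have [->|/eqP u0] := eqVneq u 0; first by rewrite dot0r.
exact/ltW/Qpos.
Qed.

Lemma posdef_eq0 (R : realType) (d : nat) (Q : 'M[R]_d) (u : 'cV[R]_d) :
  posdef Q -> dot (Q *m u) u = 0 -> u = 0.
Proof.
move=> [_ Qpos] Qu; have [//|/eqP u0] := eqVneq u 0.
by have := Qpos u u0; rewrite Qu ltxx.
Qed.

(** By symmetry, the transpose of a left kernel vector lies in the right kernel; the form vanishes
    there, so the vector is zero. *)
Lemma posdef_unitmx (R : realType) (d : nat) (Q : 'M[R]_d) :
  posdef Q -> Q \in unitmx.
Proof.
move=> Qpd; have [Qsym _] := Qpd.
rewrite -row_free_unit -kermx_eq0; apply/rowV0P => v /sub_kermxP vQ.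
apply: trmx_inj; rewrite trmx0; apply: (posdef_eq0 Qpd).
by rewrite -{1}Qsym -trmx_mul vQ trmx0 dotC dot0r.
Qed.

Lemma posdefZ (R : realType) (d : nat) (a : R) (Q : 'M[R]_d) :
  0 < a -> posdef Q -> posdef (a *: Q).
Proof.
move=> a0 [Qsym Qpos]; split; first by rewrite linearZ /= Qsym.
by move=> u /Qpos Qu; rewrite -scalemxAl dotZl mulr_gt0.
Qed.

(** Used with [a] the total mass and [Q] the matrix $K_1$: the quadratic part of the equation has no
    cross term between $\beta_0$ and $\beta$. *)
Lemma posdef_block_diag (R : realType) (d : nat) (a : R) (Q : 'M[R]_d) :
  0 < a -> posdef Q -> posdef (block_mx (a%:M : 'M_1) 0 0 Q).
Proof.
move=> a0 Qpd; have [Qsym Qpos] := Qpd; split.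
  by rewrite tr_block_mx !trmx0 tr_scalar_mx Qsym.
move=> u; rewrite -(vsubmxK u) mul_block_col !mul0mx addr0 add0r dot_col_mx.
move: (usubmx u) (dsubmx u) => t v tv0.
rewrite mul_scalar_mx dotZl {1}/dot big_ord1 -expr2.
have [v0|/eqP v0] := eqVneq v 0; last first.
  by apply: ltr_wpDl (Qpos v v0); rewrite mulr_ge0 ?sqr_ge0 // ltW.
rewrite v0 dot0r addr0 mulr_gt0 // lt_def sqr_ge0 sqrf_eq0 andbT.
apply/eqP => t0; apply: tv0; rewrite v0 (_ : t = 0) ?col_mx0 //.
by apply/matrixP => i j; rewrite !ord1 t0 mxE.
Qed.

(** * Level sets of a positive definite form around a fixed center *)

Section QuadricFamily.

Variables (R : realType) (d : nat) (Q : 'M[R]_d) (c : 'cV[R]_d) (mu0 : R).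
Hypothesis Qpd : posdef Q.

Let quadric (mu : R) : set 'cV[R]_d :=
  [set w | dot (Q *m (w - c)) (w - c) + mu0 = mu].

Lemma quadric_ellipsoid (mu : R) : mu0 < mu -> ellipsoid (quadric mu).
Proof.
rewrite -subr_gt0 => mu_gt; exists c, ((mu - mu0)^-1 *: Q); split.
  by apply: posdefZ Qpd; rewrite invr_gt0.
apply/seteqP; split => w /=; rewrite -scalemxAl dotZl => E.
  by rewrite (canRL (addrK _) E) mulVf // gt_eqF.
apply: (canLR (subrK _)); apply: (mulfI (invr_neq0 (lt0r_neq0 mu_gt))).
  by rewrite E mulVf // gt_eqF.
Qed.

(** The form is homogeneous of degree 2, so scaling about the common center [c] by $r$ multiplies
    its values by $r^2$; this dictates the square root in the ratio. *)
Lemma quadric_homothetic (mu mu' : R) :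
  mu0 < mu -> mu0 < mu' -> homothetic (quadric mu) (quadric mu').
Proof.
rewrite -subr_gt0 => mu_gt; rewrite -subr_gt0 => mu'_gt.
have q_gt0 : 0 < (mu' - mu0) / (mu - mu0) by rewrite divr_gt0.
pose r := Num.sqrt ((mu' - mu0) / (mu - mu0)).
have r_neq0 : r != 0 by rewrite gt_eqF // sqrtr_gt0.
have rr : r * r = (mu' - mu0) / (mu - mu0) by rewrite -expr2 sqr_sqrtr // ltW.
exists c, r; split => //.
apply/seteqP; split => w /=.
  (* The preimage of [w] is given by the inverse homothety, of ratio $r^{-1}$ about [c]. *)
  move=> E; exists (c + r^-1 *: (w - c)); last first.
    by rewrite /homothety [c + _ - c]addrAC subrr add0r scalerKV // subrKC.
  rewrite /quadric /= [c + _ - c]addrAC subrr add0r -scalemxAr dotZl dotZr mulrA -invfM rr.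
  by rewrite (canRL (addrK _) E) invf_div divfK ?subrK // gt_eqF.
move=> [v E <-]; rewrite /homothety /quadric /= [c + _ - c]addrAC subrr add0r.
rewrite -scalemxAr dotZl dotZr mulrA rr.
by rewrite (canRL (addrK _) E) divfK ?subrK // gt_eqF.
Qed.

Lemma quadric_center : quadric mu0 = [set c].
Proof.
apply/seteqP; split => w /=; last first.
  by move=> ->; rewrite /quadric /= subrr dot0r add0r.
move=> /(canRL (addrK _)); rewrite subrr => /(posdef_eq0 Qpd).
by move/eqP; rewrite subr_eq0 => /eqP.
Qed.

Lemma quadric_empty (mu : R) : mu < mu0 -> quadric mu = set0.
Proof.
move=> mu_lt; apply/seteqP; split => // w /= E.
by move: mu_lt; rewrite -E gtrDr ltNge (posdef_ge0 (w - c) Qpd).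
Qed.

End QuadricFamily.

(** The center solves $Qc=b$, and symmetry of $Q$ turns both cross terms into $\langle
    b,u\rangle$. *)
Lemma dot_complete_square (R : realType) (d : nat) (Q : 'M[R]_d)
    (b u : 'cV[R]_d) : posdef Q ->
  let c := invmx Q *m b in
  dot (Q *m u) u - 2 * dot b u = dot (Q *m (u - c)) (u - c) - dot b c.
Proof.
move=> Qpd c; have [Qsym _] := Qpd.
have Qc : Q *m c = b by rewrite mulKVmx // posdef_unitmx.
have Quc : dot (Q *m u) c = dot b u by rewrite dot_mulmxl Qsym Qc dotC.
rewrite mulmxBr Qc dotBl !dotBr Quc; ring.
Qed.

(** * Inertia and moments as mass-weighted sums over the points *)

Definition slope (R : realType) (n : nat) (u : 'cV[R]_n) (y : 'cV[R]_n.+1) : R :=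
  \sum_(j < n) u j 0 * y (lift ord_max j) 0.

Section Inertia.

Variables (R : realType) (n N : nat) (m : 'I_N -> R) (x : 'I_N -> 'cV[R]_n.+1).

Lemma dot_upper_left_inertia (u v : 'cV[R]_n) :
  dot (upper_left (inertia_op m x) *m u) v
  = \sum_(i < N) m i * slope u (x i) * slope v (x i).
Proof.
rewrite /dot.
under eq_bigr => j _.
  rewrite mxE mulr_suml.
  under eq_bigr => l _ do rewrite !mxE mulr_suml mulr_suml.
  rewrite exchange_big; over.
rewrite exchange_big; apply: eq_bigr => i _.
rewrite [RHS]mulr_sumr; apply: eq_bigr => j _.
rewrite /slope mulr_sumr mulr_suml; apply: eq_bigr => l _; ring.
Qed.

Lemma dot_last_col_inertia (u : 'cV[R]_n) :
  dot (last_col (inertia_op m x)) u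
  = \sum_(i < N) m i * x i ord_max 0 * slope u (x i).
Proof.
rewrite /dot; under eq_bigr => j _ do rewrite !mxE mulr_suml.
rewrite exchange_big; apply: eq_bigr => i _.
rewrite mulr_sumr; apply: eq_bigr => j _; ring.
Qed.

Lemma center0_coord (l : 'I_n.+1) :
  \sum_(i < N) m i *: x i = 0 -> \sum_(i < N) m i * x i l 0 = 0.
Proof.
move=> /matrixP/(_ l 0); rewrite summxE mxE => sum0.
by rewrite -[RHS]sum0; apply: eq_bigr => i _; rewrite mxE.
Qed.

Lemma center0_slope (u : 'cV[R]_n) :
  \sum_(i < N) m i *: x i = 0 -> \sum_(i < N) m i * slope u (x i) = 0.
Proof.
move=> c0; under eq_bigr => i _ do rewrite mulr_sumr.
rewrite exchange_big big1 // => j _.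
rewrite -[RHS](mulr0 (u j 0)) -[in RHS](center0_coord (lift ord_max j) c0).
by rewrite mulr_sumr; apply: eq_bigr => i _; rewrite mulrCA.
Qed.

Lemma coef_formE (beta0 : R) (beta : 'cV[R]_n) :
  \sum_(i < N) m i *: x i = 0 ->
  coef_form m x beta0 beta
  = \sum_(i < N) m i * (beta0 + slope beta (x i) - x i ord_max 0) ^+ 2.
Proof.
move=> c0; rewrite /coef_form dot_upper_left_inertia dot_last_col_inertia mxE.
(* The last two sums vanish by the centering condition; inserting them supplies the cross terms in
   $\beta_0$, so that the squares can be expanded point by point. *)
transitivity (\sum_(i < N) m i * slope beta (x i) * slope beta (x i)
  - 2 * \sum_(i < N) m i * x i ord_max 0 * slope beta (x i)
  + total_mass m * beta0 ^+ 2 + \sum_(i < N) m i * x i ord_max 0 * x i ord_max 0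
  + 2 * beta0 * \sum_(i < N) m i * slope beta (x i)
  - 2 * beta0 * \sum_(i < N) m i * x i ord_max 0).
  by rewrite center0_slope // center0_coord // !mulr0 subr0 addr0.
rewrite /total_mass !mulr_sumr !mulr_suml -!sumrN -!big_split /=.
by apply: eq_bigr => i _; ring.
Qed.

(** The kernel of a nonzero functional is a proper subspace, here one through the origin containing
    all the points. *)
Lemma full_rank_functional (a : 'rV[R]_n.+1) :
  ~ in_proper_affine_subspace x -> (forall i, a *m x i = 0) -> a = 0.
Proof.
move=> full_rank ax; apply/matrixP => i l; rewrite ord1 mxE.
have [//|al] := eqVneq (a 0 l) 0; case: full_rank.
pose f := linfun (mulmx a : 'cV[R]_n.+1 -> 'cV[R]_1).
exists 0, (lker f); split.
  (* The [l]-th basis vector is sent to [a 0 l], which is nonzero, so the kernel is not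
     everything. *)
  move=> kerT; have : delta_mx l 0 \in lker f by rewrite kerT memvf.
  rewrite memv_ker lfunE /= => /eqP/matrixP/(_ 0 0).
  by rewrite -colE !mxE => /eqP; rewrite (negPf al).
by move=> j; rewrite subr0 memv_ker lfunE /= ax.
Qed.

Lemma slope_eq0 (u : 'cV[R]_n) :
  ~ in_proper_affine_subspace x -> (forall i, slope u (x i) = 0) -> u = 0.
Proof.
move=> full_rank ux.
(* Extend [u] by a zero coefficient on $x_k$ to get a functional on the whole space. *)
pose a : 'rV[R]_n.+1 := \row_l oapp (fun j => u j 0) 0 (unlift ord_max l).
have aE (j : 'I_n) : a 0 (lift ord_max j) = u j 0 by rewrite mxE liftK.
suff a0 : a = 0 by apply/matrixP => j k; rewrite ord1 -aE a0 !mxE.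
apply: full_rank_functional full_rank _ => i.
apply/matrixP => j k; rewrite !ord1 !mxE (bigD1_ord ord_max) //=.
rewrite mxE unlift_none mul0r add0r -[RHS](ux i).
by apply: eq_bigr => l _; rewrite aE.
Qed.

(** The form is a sum of nonnegative terms $m_i\,\mathtt{slope}(u,x_i)^2$; if it vanishes, so does
    each slope, and full rank forces $u=0$. *)
Lemma posdef_upper_left_inertia :
  (forall i, 0 < m i) -> ~ in_proper_affine_subspace x ->
  posdef (upper_left (inertia_op m x)).
Proof.
move=> m_gt0 full_rank; split.
  apply/matrixP => j l; rewrite !mxE.
  by apply: eq_bigr => i _; rewrite mulrAC.
move=> u u0; rewrite dot_upper_left_inertia.
have term_ge0 i : 0 <= m i * slope u (x i) * slope u (x i).
  by rewrite -mulrA -expr2 mulr_ge0 ?sqr_ge0 ?ltW.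
rewrite lt_def sumr_ge0 // andbT; apply/eqP => /eqP.
rewrite psumr_eq0 // => /allP sum0; apply: u0; apply: slope_eq0 => // i.
have := sum0 i (mem_index_enum i).
by rewrite !mulf_eq0 gt_eqF //= orbb => /eqP.
Qed.

Lemma total_mass_gt0 :
  (forall i, 0 < m i) -> ~ in_proper_affine_subspace x -> 0 < total_mass m.
Proof.
move=> m_gt0 full_rank.
(* Full rank guarantees at least one point: with none, every functional, such as the all-ones row,
   would vanish on all the points. *)
have [i0 _] : exists i : 'I_N, True.
  apply: contrapT => noi.
  suff /matrixP/(_ 0 0) : const_mx 1 = 0 :> 'rV[R]_n.+1.
    by rewrite !mxE => /eqP; rewrite oner_eq0.
  by apply: full_rank_functional full_rank _ => i; case: noi; exists i.
rewrite /total_mass (bigD1 i0) //= ltr_pwDl //.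
by apply: sumr_ge0 => i _; apply: ltW.
Qed.

(** Moving along the $x_k$-axis changes only the last coordinate, so the line through a point meets
    the hyperplane at exactly one parameter, the residual, whose absolute value is the distance. *)
Lemma directional_momentE (beta0 : R) (beta : 'cV[R]_n) :
  directional_moment m x (delta_mx ord_max 0) (hyperplane beta0 beta)
  = \sum_(i < N) m i * (beta0 + slope beta (x i) - x i ord_max 0) ^+ 2.
Proof.
apply: eq_bigr => i _; congr (_ * _); move: (x i) => p.
have slope_shift t : slope beta (p + t *: delta_mx ord_max 0) = slope beta p.
  apply: eq_bigr => j _; rewrite !mxE.
  by rewrite [_ == ord_max]eq_sym (negPf (neq_lift _ _)) mulr0 addr0.
set A := hyperplane beta0 beta `&` line p (delta_mx ord_max 0).
have AE t : hyperplane beta0 beta (p + t *: delta_mx ord_max 0) <->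
            t = beta0 + slope beta p - p ord_max 0.
  rewrite -(slope_shift t) /hyperplane /= !mxE !eqxx mulr1 -/(slope _ _).
  by split=> [<-|{1}->]; rewrite [p _ _ + _]addrC ?addrK ?subrK.
(* The intersection is nonempty, so [xget] returns a point of it and not its default [p]. *)
have : A (xget p A).
  apply: xgetPex; set t := beta0 + slope beta p - p ord_max 0.
  by exists (p + t *: delta_mx ord_max 0); split; [apply/AE | exists t].
rewrite /directional_dist -/A => -[+ [t yE]]; rewrite yE => /AE <-.
rewrite /edist opprD addNKr -scaleNr dotZl dotZr mulrA mulrNN -expr2.
have -> : dot (delta_mx ord_max 0 : 'cV[R]_n.+1) (delta_mx ord_max 0) = 1.
  by rewrite dotE trmx_delta mul_delta_mx mxE !eqxx.
by rewrite mulr1 sqr_sqrtr ?sqr_ge0.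
Qed.

(** Only $\beta$ needs completing the square; $\beta_0$ occurs as a pure square, hence the zero
    first coordinate of the center. *)
Lemma coef_locusE (mu : R) :
  (forall i, 0 < m i) -> ~ in_proper_affine_subspace x ->
  let J := inertia_op m x in
  let beta := invmx (upper_left J) *m last_col J in
  let Q := block_mx (total_mass m)%:M 0 0 (upper_left J) in
  let c := col_mx 0 beta in
  let mu0 := J ord_max ord_max - dot (last_col J) beta in
  coef_locus m x mu = [set w | dot (Q *m (w - c)) (w - c) + mu0 = mu].
Proof.
move=> m_gt0 full_rank J beta Q c mu0.
have key t v : coef_form m x t v
    = dot (Q *m (col_mx t%:M v - c)) (col_mx t%:M v - c) + mu0.
  rewrite /coef_form -/J dot_complete_square; last exact: posdef_upper_left_inertia.
  rewrite -/beta opp_col_mx add_col_mx oppr0 addr0 mul_block_col !mul0mx.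
  rewrite addr0 add0r dot_col_mx mul_scalar_mx dotZl.
  rewrite {3}/dot big_ord1 [_%:M _ _]mxE eqxx mulr1n /mu0; ring.
apply/seteqP; split => w /=.
  by move=> [t [v [-> <-]]]; rewrite key.
move=> E; exists (usubmx w 0 0), (dsubmx w).
have wE : w = col_mx (usubmx w 0 0)%:M (dsubmx w) by rewrite -mx11_scalar vsubmxK.
by split => //; rewrite key -wE.
Qed.

End Inertia.

Theorem proposition2p2 (R : realType) (n N : nat) (hk : (2 <= n.+1)%N)
    (m : 'I_N -> R) (x : 'I_N -> 'cV[R]_n.+1)
    (m_gt0 : forall i, 0 < m i)
    (full_rank : ~ in_proper_affine_subspace x)
    (center0 : \sum_(i < N) m i *: x i = 0) :
  (forall (mu beta0 : R) (beta : 'cV[R]_n),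
     directional_moment m x (delta_mx ord_max 0) (hyperplane beta0 beta) = mu ->
     coef_form m x beta0 beta = mu) /\
  (exists mu0 : R,
     [/\ forall mu : R, mu0 < mu -> ellipsoid (coef_locus m x mu),
         forall mu mu' : R, mu0 < mu -> mu0 < mu' ->
           homothetic (coef_locus m x mu) (coef_locus m x mu'),
         exists w, coef_locus m x mu0 = [set w]
       & forall mu : R, mu < mu0 -> coef_locus m x mu = set0]).
Proof.
split=> [mu beta0 beta <-|]; first by rewrite coef_formE // directional_momentE.
set J := inertia_op m x.
set beta := invmx (upper_left J) *m last_col J.
have Qpd : posdef (block_mx ((total_mass m)%:M : 'M_1) 0 0 (upper_left J)).
  apply: posdef_block_diag; first exact: total_mass_gt0 m_gt0 full_rank.
  exact: posdef_upper_left_inertia.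
(* The threshold is the value of the equation's left side at its center, the regression hyperplane;
   there the ellipsoid shrinks to a point. *)
exists (J ord_max ord_max - dot (last_col J) beta); split=> [mu|mu mu'||mu].
- by rewrite coef_locusE //; apply: quadric_ellipsoid.
- by rewrite !coef_locusE //; apply: quadric_homothetic.
- by exists (col_mx 0 beta); rewrite coef_locusE //; apply: quadric_center.
- by rewrite coef_locusE //; apply: quadric_empty.
Qed.
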